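(* Let $1\le k<N/2$. There is a quantum algorithm that, for every unknown $x\in\{0,1\}^N$ with $wt(x)=k$, finds $x$ with bounded error using $O(k^{1/4})$ queries to the quasi B-oracle for $x$.
   Context: For $x,q\in\{0,1\}^N$ let $x\wedge q$ be the bitwise AND and $wt$ the Hamming weight. The quasi B-oracle is a stochastic oracle with random answer $\zeta(x;q)\in\{0,1\}$ where $\Pr[\zeta(x;q)=0]=0$ if $wt(x\wedge q)$ is odd, $\Pr[\zeta(x;q)=0]=\sqrt{1/wt(x\wedge q)}$ if $wt(x\wedge q)$ is positive and even, and $\Pr[\zeta(x;q)=0]=1$ if $wt(x\wedge q)=0$. It is accessed through the unitary $\tilde O_x|q,a,z\rangle=\sqrt{\Pr[\zeta(x;q)=0]}\,|q,a,z\rangle+(-1)^a\sqrt{\Pr[\zeta(x;q)=1]}\,|q,a\oplus1,z\rangle$, where $a$ is a one-bit answer register and $z$ a workspace register. (It models a balance where the weighed coin set $\{i:q_i=1\}$ is split between the two pans uniformly at random.) Bounded error: output equals $x$ with probability at least a constant such as $2/3$. *)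

(* Defs.v *)
From HB Require Import structures.
From mathcomp Require Import all_boot all_order all_algebra.
From mathcomp Require Import reals.
From mathcomp Require Import complex.
Set Implicit Arguments. Unset Strict Implicit. Unset Printing Implicit Defensive.
Import Order.TTheory GRing.Theory Num.Theory.
Local Open Scope ring_scope.

Notation bits N := {ffun 'I_N -> bool}.

Definition wt (N : nat) (x : bits N) : nat := #|[pred i | x i]|.
Definition band (N : nat) (x q : bits N) : bits N := [ffun i => x i && q i].

Definition prob0 (R : realType) (N : nat) (x q : bits N) : R :=
  let w := wt (band x q) in
  if w == 0%N then 1
  else if odd w then 0
  else Num.sqrt (1 / w%:R).

(* Computational basis of the register space |q, a, z>: query register
   q in {0,1}^N, one answer bit a, workspace z in {0, ..., W} (W+1 values,
   so the workspace is never empty). *)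
Definition basis (N W : nat) := (bits N * bool * 'I_W.+1)%type.

(* States: amplitude functions on the basis.
   Operators: matrices given by their entries  op y x = <y| op |x>. *)
Definition state (R : realType) (N W : nat) := basis N W -> R[i].
Definition op (R : realType) (N W : nat) := basis N W -> basis N W -> R[i].

Definition apply_op (R : realType) (N W : nat) (M : op R N W) (psi : state R N W)
  : state R N W := fun y => \sum_(x : basis N W) M y x * psi x.

(* Unitarity (in finite dimension, M^* M = 1 is equivalent to unitarity). *)
Definition unitary (R : realType) (N W : nat) (M : op R N W) : Prop :=
  forall x x' : basis N W,
    \sum_(y : basis N W) (M y x)^* * M y x' = (x == x')%:R.

(* The quasi B-oracle unitary
   O~_x |q,a,z> = sqrt(Pr[zeta=0]) |q,a,z> + (-1)^a sqrt(Pr[zeta=1]) |q,a+1,z>. *)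
Definition quasiB_oracle (R : realType) (N W : nat) (x : bits N) : op R N W :=
  fun y b =>
    let: (q, a, z) := b in
    let: (q', a', z') := y in
    let s : R := Num.sqrt (prob0 R x q) in
    let t : R := Num.sqrt (1 - prob0 R x q) in
    if (q' == q) && (z' == z) then
      (if a' == a then (s%:C)%C else if a then ((- t)%:C)%C else (t%:C)%C)
    else 0.

(* A quantum query algorithm with workspace size W.+1 making [nq] queries:
   unitaries U_0, ..., U_nq interleaved with nq oracle calls, started
   from |0...0, 0, 0>, followed by a computational-basis measurement of the
   whole register and classical post-processing [out]. *)
Record qalg (R : realType) (N W : nat) := QAlg {
  nq : nat;
  gate : nat -> op R N W;
  out : basis N W -> bits N
}.

Definition init_state (R : realType) (N W : nat) : state R N W :=
  fun b => if b == ([ffun=> false], false, ord0) then 1 else 0.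

Fixpoint run_aux (R : realType) (N W : nat) (A : qalg R N W) (x : bits N)
  (n : nat) : state R N W :=
  match n with
  | 0 => apply_op (gate A 0) (@init_state R N W)
  | n'.+1 => apply_op (gate A n) (apply_op (@quasiB_oracle R N W x) (run_aux A x n'))
  end.

Definition final_state (R : realType) (N W : nat) (A : qalg R N W) (x : bits N)
  : state R N W := run_aux A x (nq A).

Definition valid_qalg (R : realType) (N W : nat) (A : qalg R N W) : Prop :=
  forall j, (j <= nq A)%N -> unitary (gate A j).

Definition prob_output (R : realType) (N W : nat) (A : qalg R N W)
  (x y : bits N) : R[i] :=
  \sum_(b : basis N W | out A b == y) `|final_state A x b| ^+ 2.

(* Main.v *)
From HB Require Import structures.
From mathcomp Require Import all_boot all_order all_algebra.
From mathcomp Require Import sesquilinear spectral ring lra zify.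
From mathcomp Require Import reals complex.
From mathcomp Require Import classical_sets topology normedtype derive trigo.
Require Import Defs.
Import Order.TTheory GRing.Theory Num.Theory numFieldNormedType.Exports.
Local Open Scope ring_scope.
Local Open Scope sesquilinear_scope.

Set Implicit Arguments. Unset Strict Implicit. Unset Printing Implicit Defensive.

(** For a fixed query [q] the oracle is a rotation of the answer qubit, by a
    quarter turn when [w = wt (x /\ q)] is odd and by [pi / 2 - phi] with
    [sin phi = w ^ (-1/4)] when [w] is even and positive. If a circuit on the
    answer qubit turns these rotations into operators whose (0,0) entry is close
    to [(-1)^w] for most [q], then running it on a uniform superposition of
    queries and applying the Hadamard transform to the query register reads off
    [x], as in the Bernstein-Vazirani algorithm. For large [k] the circuit just
    repeats the oracle [n = 2 mod 4] times with [n] close to [pi (k/2)^(1/4)]: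
    the entry is [cos (n phi - pi)], which is [-1] for odd [w] and close to [1]
    when [w] is close to [k / 2], hence for most [q] by Chebyshev's inequality.
    For bounded [k] a constant number of rounds of Grover's [pi/3] fixed-point
    search serves all [w] simultaneously. *)

(** * Characters of the group of bit strings *)

Definition chi (A : comPzRingType) (N : nat) (x q : bits N) : A :=
  (-1) ^+ wt (band x q).

Lemma chi_prod (A : comPzRingType) (N : nat) (x q : bits N) :
  chi A x q = \prod_(i < N) (-1) ^+ (x i && q i).
Proof.
rewrite prodrXr /chi /wt -sum1_card big_mkcond /=; congr (_ ^+ _).
by apply: eq_bigr => i _; rewrite inE ffunE; case: (_ && _).
Qed.

Lemma chiC (A : comPzRingType) (N : nat) (x q : bits N) : chi A x q = chi A q x.
Proof. by rewrite !chi_prod; apply: eq_bigr => i _; rewrite andbC. Qed.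

(** The sum over [q] factors into one two-term sum per coordinate; the factor at a coordinate where
    [x] and [y] differ vanishes. *)
Lemma chi_orthogonal (A : comPzRingType) (N : nat) (x y : bits N) :
  \sum_(q : bits N) chi A x q * chi A y q = (x == y)%:R * 2 ^+ N.
Proof.
pose F i b : A := (-1) ^+ (x i && b) * (-1) ^+ (y i && b).
have -> : \sum_(q : bits N) chi A x q * chi A y q =
          \sum_(q : bits N) \prod_(i < N) F i (q i).
  by apply: eq_bigr => q _; rewrite !chi_prod -big_split.
rewrite -bigA_distr_bigA /=.
have FE i : \sum_b F i b = if x i == y i then 2 else 0.
  rewrite big_bool /F !andbT !andbF.
  by case: (x i); case: (y i) => /=; ring.
under eq_bigr do rewrite FE.
case: (eqVneq x y) => [->|nxy].
  under eq_bigr do rewrite eqxx.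
  by rewrite prodr_const card_ord mul1r.
have [i ni] : exists i, x i != y i.
  apply/existsP; apply: contraNT nxy => /existsPn H.
  by apply/eqP/ffunP => i; apply/eqP; rewrite -[_ == _]negbK.
by rewrite (bigD1 i) //= (negbTE ni) !mul0r.
Qed.

(** * One-qubit circuits as functions of the query gate, and their lift to query algorithms *)

Section Framework.
Variable R : realType.
Local Notation C := R[i].
Local Notation qubit_op := 'M[C]_2.

Definition ket (a : bool) : 'I_2 := if a then 1 else 0.

Lemma ketK (a b : bool) : (ket a == ket b) = (a == b).
Proof. by case: a; case: b. Qed.

Lemma sum_ket (F : 'I_2 -> C) : \sum_(a : bool) F (ket a) = \sum_i F i.
Proof. by rewrite big_bool big_ord_recl big_ord1 addrC; congr (F _ + F _); apply/val_inj. Qed.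

Fixpoint interleave (g : nat -> qubit_op) (U : qubit_op) n : qubit_op :=
  if n is n'.+1 then g n *m (U *m interleave g U n') else g 0%N.

Lemma eq_interleave (g h : nat -> qubit_op) U n :
  (forall j, (j <= n)%N -> g j = h j) -> interleave g U n = interleave h U n.
Proof.
elim: n => [|n IH] gh /=; first exact: gh.
by rewrite gh 1?IH ?leqnn => // j jn; apply/gh/leqW.
Qed.

(** The gates are chosen before [U]: a single circuit must run in all branches [q] of the
    superposition, each branch supplying its own query rotation. *)
Definition realizable n (F : qubit_op -> qubit_op) :=
  exists2 g : nat -> qubit_op,
    (forall j, g j \is unitarymx) & (forall U, F U = interleave g U n).

Lemma realizable_const V : V \is unitarymx -> realizable 0 (fun=> V).
Proof. by move=> Vu; exists (fun=> V). Qed.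

Lemma realizable_query : realizable 1 id.
Proof.
exists (fun=> 1%:M) => [_|U]; last by rewrite /= mulmx1 mul1mx.
by apply/unitarymxP; rewrite mul1mx trmx1 map_mx1.
Qed.

(** The last gate of the circuit for [G] and the first gate of the circuit for [F] merge into one,
    so query counts add exactly. *)
Lemma realizable_mul n m F G : realizable n F -> realizable m G ->
  realizable (n + m) (fun U => F U *m G U).
Proof.
move=> [f fu fE] [g gu gE].
suff [h hu hE] : realizable (n + m) (fun U => interleave f U n *m interleave g U m).
  by exists h => // U; rewrite fE gE hE.
elim: n {F fE} => [|n [h hu hE]].
  exists (fun j => if j == m then f 0%N *m g j else g j) => [j|U /=].
    by case: eqP => // _; apply: mul_unitarymx.
  case: m {gE G} => [|m] //=; rewrite !eqxx mulmxA; congr (_ *m (U *m _)).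
  by apply: eq_interleave => j jm; rewrite ltn_eqF.
exists (fun j => if j == (n + m).+1 then f n.+1 else h j) => [j|U /=].
  by case: eqP.
rewrite eqxx -!mulmxA; congr (_ *m (U *m _)); rewrite hE.
by apply: eq_interleave => j jm; rewrite ltn_eqF.
Qed.

Lemma realizable_unitary n F U : realizable n F -> U \is unitarymx -> F U \is unitarymx.
Proof.
move=> [g gu ->] Uu; elim: n => [|n IH]; first exact: gu.
exact: mul_unitarymx (gu _) (mul_unitarymx Uu IH).
Qed.

Definition rotmx (s t : R) : qubit_op :=
  \matrix_(i, j) if i == j then (s%:C)%C else if j == 0 then (t%:C)%C else ((- t)%:C)%C.

Definition query_mx N (x q : bits N) : qubit_op :=
  rotmx (Num.sqrt (prob0 R x q)) (Num.sqrt (1 - prob0 R x q)).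

Lemma oracleE N (x : bits N) (y b : basis N 0) :
  quasiB_oracle R x y b =
  (y.1.1 == b.1.1)%:R * (y.2 == b.2)%:R * query_mx x b.1.1 (ket y.1.2) (ket b.1.2).
Proof.
case: y => [[q' a'] z']; case: b => [[q a] z] /=; rewrite mxE ketK.
rewrite -natrM mulnb.
case: ((q' == q) && (z' == z)); rewrite ?mul0r ?mul1r //.
by case: a; case: a'.
Qed.

Definition product_op N (K : bits N -> bits N -> C) (V : qubit_op) : op R N 0 :=
  fun y b => K y.1.1 b.1.1 * V (ket y.1.2) (ket b.1.2).

Lemma sum_basis0 N (F : basis N 0 -> C) :
  \sum_b F b = \sum_(q : bits N) \sum_(a : bool) F (q, a, ord0).
Proof.
transitivity (\sum_(p : (bits N * bool) * 'I_1) F (p.1, p.2)).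
  by apply: eq_bigr => -[].
rewrite -(pair_bigA _ (fun p z => F (p, z))) /=.
under eq_bigr do rewrite big_ord1.
rewrite (pair_bigA _ (fun q a => F (q, a, ord0))) /=.
by apply: eq_bigr => -[].
Qed.

Lemma product_op_unitary N (K : bits N -> bits N -> C) V :
  (forall q q', \sum_p (K p q)^* * K p q' = (q == q')%:R) ->
  V \is unitarymx -> unitary (product_op K V).
Proof.
move=> Ku /unitarymxP /mulmx1C Vu [[q a] z] [[q' a'] z'].
rewrite sum_basis0 /product_op /=.
have VE : \sum_(b : bool) (V (ket b) (ket a))^* * V (ket b) (ket a') = (a == a')%:R.
  rewrite (sum_ket (fun i => (V i (ket a))^* * V i (ket a'))) -ketK.
  move/matrixP: Vu => /(_ (ket a) (ket a')); rewrite !mxE => <-.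
  by apply: eq_bigr => i _; rewrite !mxE.
rewrite (ord1 z) (ord1 z') !xpair_eqE eqxx andbT -mulnb natrM -VE -Ku big_distrl /=.
apply: eq_bigr => p _; rewrite big_distrr /=; apply: eq_bigr => b _.
by rewrite rmorphM /=; ring.
Qed.

(** The factor 2^(-N/2), written as a square root to cover odd [N]. *)
Definition hadamard_scale (N : nat) : C := ((Num.sqrt (2 ^- N))%:C)%C.

Lemma hadamard_scale_sqr N : hadamard_scale N * hadamard_scale N = 2 ^- N.
Proof.
rewrite -rmorphM /= -expr2 sqr_sqrtr; last by rewrite invr_ge0 exprn_ge0.
by rewrite fmorphV rmorphXn rmorph_nat.
Qed.

Definition id_kernel N (p q : bits N) : C := (p == q)%:R.

Definition hadamard N (p q : bits N) : C := hadamard_scale N * chi C p q.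

Lemma id_kernel_unitary N (q q' : bits N) :
  \sum_p (id_kernel p q)^* * id_kernel p q' = (q == q')%:R.
Proof.
rewrite (bigD1 q) //= big1 ?addr0 => [|p /negbTE pq]; rewrite /id_kernel.
  by rewrite eqxx rmorph1 mul1r.
by rewrite pq rmorph0 mul0r.
Qed.

Lemma hadamard_unitary N (q q' : bits N) :
  \sum_p (hadamard p q)^* * hadamard p q' = (q == q')%:R.
Proof.
transitivity (2 ^- N * ((q == q')%:R * 2 ^+ N) : C); last first.
  by rewrite mulrCA mulVf ?mulr1 // expf_neq0 // pnatr_eq0.
rewrite -[X in _ * X]chi_orthogonal -hadamard_scale_sqr big_distrr /=.
apply: eq_bigr => p _; rewrite /hadamard rmorphM /= !(chiC _ p).
have -> : (hadamard_scale N)^* = hadamard_scale N.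
  by apply: conj_Creal; rewrite ger0_real // /hadamard_scale ler0c sqrtr_ge0.
by rewrite /chi rmorphXn rmorphN1; ring.
Qed.

(** Invariant shape of the states: the same amplitude [c] in every branch [q], with the answer qubit
    in column 0 of [F q], that is, in the image of its initial state. *)
Lemma apply_oracle N (x : bits N) (F : bits N -> qubit_op) c (psi : state R N 0) :
  (forall b, psi b = c * F b.1.1 (ket b.1.2) 0) ->
  forall b, apply_op (quasiB_oracle R x) psi b =
            c * (query_mx x b.1.1 *m F b.1.1) (ket b.1.2) 0.
Proof.
move=> psiE [[q a] z]; rewrite /apply_op.
under eq_bigr do rewrite oracleE psiE.
rewrite sum_basis0 (bigD1 q) //= [X in _ + X]big1 ?addr0 => [|p pq]; last first.
  by rewrite big1 // => b _; rewrite eq_sym (negbTE pq) !mul0r.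
rewrite mxE big_distrr /= -(sum_ket (fun i => c * (query_mx x q (ket a) i * F q i 0))).
by apply: eq_bigr => b _; rewrite eqxx (ord1 z) !mul1r; ring.
Qed.

Lemma apply_product N K V (F : bits N -> qubit_op) c (psi : state R N 0) :
  (forall b, psi b = c * F b.1.1 (ket b.1.2) 0) ->
  forall b, apply_op (product_op K V) psi b =
            \sum_q K b.1.1 q * (c * (V *m F q) (ket b.1.2) 0).
Proof.
move=> psiE [[q a] z]; rewrite /apply_op sum_basis0; apply: eq_bigr => p _ /=.
rewrite mxE !big_distrr /=.
rewrite -(sum_ket (fun i => K q p * (c * (V (ket a) i * F p i 0)))).
by apply: eq_bigr => b _; rewrite psiE /product_op /=; ring.
Qed.

(* Hadamard transforms of the query register are merged into the first and last
   gates, which therefore must be distinct: hence [0 < n] below. *)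
Definition conjugated_alg N n (g : nat -> qubit_op) : qalg R N 0 :=
  QAlg n
    (fun j => product_op (if (j == 0%N) || (j == n) then @hadamard N else @id_kernel N) (g j))
    (fun b => b.1.1).

(** The first Hadamard transform acts on the zero string, where all characters are 1, and so
    produces the uniform superposition. Until the last gate the branches do not interact. *)
Lemma conjugated_alg_state N n g (x : bits N) j (b : basis N 0) : (j < n)%N ->
  run_aux (conjugated_alg N n g) x j b =
  hadamard_scale N * interleave g (query_mx x b.1.1) j (ket b.1.2) 0.
Proof.
elim: j b => [|j IH] b jn /=.
  rewrite /apply_op /init_state (bigD1 ([ffun=> false], false, ord0)) //= eqxx mulr1.
  rewrite big1 ?addr0 => [|b' /negbTE ->]; last by rewrite mulr0.
  rewrite /product_op /hadamard /= chi_prod big1 ?mulr1 // => i _.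
  by rewrite ffunE andbF.
rewrite (@apply_product _ _ _ (fun q => query_mx x q *m interleave g (query_mx x q) j)
           (hadamard_scale N)); last first.
  apply: (@apply_oracle _ _ (fun q => interleave g (query_mx x q) j)) => b'.
  by apply: IH; apply: ltnW.
rewrite ltn_eqF //= (bigD1 b.1.1) //= /id_kernel eqxx mul1r big1 ?addr0 //.
by move=> q /negbTE; rewrite eq_sym => ->; rewrite mul0r.
Qed.

(** The last Hadamard transform turns the amplitude at [y] into the Fourier coefficient at [y] of
    the (0,0) entry as a function of [q]. *)
Lemma conjugated_alg_final N n g (x y : bits N) : (0 < n)%N ->
  final_state (conjugated_alg N n g) x (y, false, ord0) =
  2 ^- N * \sum_q chi C y q * interleave g (query_mx x q) n 0 0.
Proof.
case: n => // n _; rewrite /final_state /=.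
rewrite (@apply_product _ _ _ (fun q => query_mx x q *m interleave g (query_mx x q) n)
           (hadamard_scale N)); last first.
  apply: (@apply_oracle _ _ (fun q => interleave g (query_mx x q) n)) => b.
  exact: conjugated_alg_state.
rewrite eqxx -hadamard_scale_sqr big_distrr /=.
by apply: eq_bigr => q _; rewrite /hadamard; ring.
Qed.

(* The bound only counts the outcome with answer bit 0. *)
Lemma realizable_alg N n F : (0 < n)%N -> realizable n F ->
  exists A : qalg R N 0, [/\ valid_qalg A, nq A = n &
   forall (x : bits N) (f : bits N -> R) (r : R),
    (forall q, F (query_mx x q) 0 0 = ((f q)%:C)%C) ->
    0 <= r -> r * 2 ^+ N <= \sum_q chi R x q * f q ->
    ((r ^+ 2)%:C)%C <= prob_output A x x].
Proof.
move=> n_gt0 [g gu gE]; exists (conjugated_alg N n g); split=> //.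
  move=> j _ /=; case: ifP => _; apply: product_op_unitary (gu j).
    exact: hadamard_unitary.
  exact: id_kernel_unitary.
move=> x f r fE r0 rle; rewrite /prob_output (bigD1 (x, false, ord0)) //=.
apply: (@le_trans _ _ (`|final_state (conjugated_alg N n g) x (x, false, ord0)| ^+ 2)).
  rewrite conjugated_alg_final //.
  have -> : 2 ^- N * \sum_q chi C x q * interleave g (query_mx x q) n 0 0 =
            ((2 ^- N * \sum_q chi R x q * f q)%:C)%C.
    rewrite rmorphM fmorphV rmorphXn rmorph_nat rmorph_sum /=.
    congr (_ * _); apply: eq_bigr => q _.
    by rewrite rmorphM /= -fE gE /chi rmorphXn rmorphN1.
  rewrite rmorphXn /=; apply: lerXn2r; rewrite ?nnegrE ?normr_ge0 ?ler0c //.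
  apply: le_trans (real_ler_norm _); first by rewrite lecR mulrC ler_pdivlMr ?exprn_gt0.
  by apply/complex_realP; eexists.
rewrite lerDl; apply: sumr_ge0 => b _; exact: exprn_ge0.
Qed.

End Framework.

(** * Fixed-point search on the answer qubit *)

Section FixedPoint.
Variable R : realType.
Local Notation C := R[i].
Local Notation qubit_op := 'M[C]_2.

Lemma mulmx2E (A B : qubit_op) i j : (A *m B) i j = A i 0 * B 0 j + A i 1 * B 1 j.
Proof. by rewrite mxE -(sum_ket (fun l => A i l * B l j)) big_bool addrC. Qed.

Lemma qubit_opP (A B : qubit_op) :
  A 0 0 = B 0 0 -> A 0 1 = B 0 1 -> A 1 0 = B 1 0 -> A 1 1 = B 1 1 -> A = B.
Proof.
have two (i : 'I_2) : i = 0 \/ i = 1.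
  by case: i => [[|[|//]] ?]; [left|right]; apply/val_inj.
by move=> ? ? ? ?; apply/matrixP => i j; case: (two i) => ->; case: (two j) => ->.
Qed.

Definition phase_gate (c d : C) : qubit_op :=
  \matrix_(i, j) if i == j then if i == 0 then c else d else 0.

Lemma adjE (A : qubit_op) i j : (A^t*) i j = (A j i)^*.
Proof. by rewrite !mxE. Qed.

Lemma phase_gate_adj c d : (phase_gate c d)^t* = phase_gate c^* d^*.
Proof. by apply: qubit_opP; rewrite adjE !mxE /= ?rmorph0. Qed.

Lemma phase_gate_unitary c d : `|c| = 1 -> `|d| = 1 -> phase_gate c d \is unitarymx.
Proof.
move=> c1 d1; apply/unitarymxP; rewrite phase_gate_adj.
by apply: qubit_opP; rewrite mulmx2E !mxE /= ?mulr0 ?mul0r ?addr0 ?add0r //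
   -normCK ?c1 ?d1 expr1n.
Qed.

Lemma conj_real (s : R) : ((s%:C)%C : C)^* = (s%:C)%C.
Proof. by apply: conj_Creal; apply/complex_realP; exists s. Qed.

Lemma rotmx_unitary (s t : R) : s ^+ 2 + t ^+ 2 = 1 -> rotmx s t \is unitarymx.
Proof.
move=> /(congr1 (fun y => (y%:C)%C)); rewrite rmorphD !rmorphXn rmorph1 /= => st.
by apply/unitarymxP; apply: qubit_opP; rewrite mulmx2E !adjE !mxE /= !conj_real
   ?rmorphN /= -?st; ring.
Qed.

(** Conjugating by a reflection reverses a rotation, so an inverse query costs one query. *)
Lemma rotmx_adj (s t : R) :
  (rotmx s t)^t* = phase_gate 1 (-1) *m (rotmx s t *m phase_gate 1 (-1)).
Proof.
by apply: qubit_opP; rewrite !mulmx2E !adjE !mxE /= !conj_real ?rmorphN /=; ring.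
Qed.

(* [w] is a primitive sixth root of unity; then the failure probability
   [|U 1 0| ^+ 2] is cubed. *)
Lemma pi3_amplify (w : C) (U : qubit_op) : U \is unitarymx ->
  w ^+ 2 = w - 1 ->
  (U *m (phase_gate w 1 *m (U^t* *m (phase_gate w 1 *m U)))) 1 0 =
  w * U 1 0 * (U 1 0 * (U 1 0)^*).
Proof.
move=> Uu w2.
have /matrixP UU : U *m U^t* = 1%:M by apply/unitarymxP.
have /matrixP /(_ 0 0) : U^t* *m U = 1%:M by apply/mulmx1C/unitarymxP.
move: (UU 1 1) (UU 1 0); rewrite !mulmx2E !adjE !mxE /= !(mulr1n, mulr0n).
move: (U 0 0) (U 0 1) (U 1 0) (U 1 1) => u b v d.
move=> E1 E2 E3.
(* Normalisation of row 1, orthogonality of the two rows and normalisation of column 0 eliminate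
   [d], [b] and [u]. *)
have E4 : d * d^* = 1 - v * v^* by rewrite -E1; ring.
have E5 : d * b^* = - (v * u^*) by apply: (addrI (v * u^*)); rewrite E2; ring.
have E6 : u^* * u = 1 - v^* * v by rewrite -E3; ring.
transitivity (w ^+ 2 * v * (u^* * u) + w * u * (d * b^*) + w * v * (v * v^*)
   + v * (d * d^*)); first by ring.
rewrite w2 E4 E5.
transitivity (v * ((w - 1) * (u^* * u) - w * (u^* * u) + w * (v * v^*) + 1 - v * v^*)).
  by ring.
by rewrite E6; ring.
Qed.

(** Each round uses the previous circuit and its adjoint, so the induction carries a circuit [G] for
    the adjoint along with [F]. A round triples the queries and cubes the failure probability, which
    starts at [t ^+ 2]. *)
Lemma realizable_amplify r : exists m F G,
  [/\ (0 < m)%N, realizable m F, realizable m G & forall s t : R, s ^+ 2 + t ^+ 2 = 1 ->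
    G (rotmx s t) = (F (rotmx s t))^t* /\
    `|F (rotmx s t) 1 0| ^+ 2 = (((t ^+ 2) ^+ (3 ^ r))%:C)%C].
Proof.
pose Z := phase_gate 1 (-1).
have Zu : Z \is unitarymx by apply: phase_gate_unitary; rewrite ?normrN normr1.
elim: r => [|r [m [F [G [m0 Fr Gr FG]]]]].
  exists 1%N, id, (fun U => Z *m (U *m Z)); split => //.
  - exact: realizable_query.
  - apply: (realizable_mul (n := 0) (F := fun=> Z)); first exact: realizable_const.
    apply: (realizable_mul (n := 1) (m := 0) (F := id) (G := fun=> Z)).
      exact: realizable_query.
    exact: realizable_const.
  - move=> s t st; rewrite rotmx_adj; split => //.
    by rewrite mxE /= normCK conj_real expr1 expr2 rmorphM.
(* This is exp(i pi / 3). *)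
pose w : C := (Complex (1 / 2) (Num.sqrt 3 / 2)).
have w2 : w ^+ 2 = w - 1.
  apply/eqP; rewrite eq_complex expr2 /=.
  have := sqr_sqrtr (ler0n R 3); set q := Num.sqrt _ => q2.
  apply/andP; split; apply/eqP; last by field.
  transitivity (1 / 4 - q ^+ 2 / 4); first by field.
  by rewrite q2; field.
have w1 : `|w| = 1.
  rewrite normc_def /= !exprMn sqr_sqrtr ?ler0n //.
  by rewrite (_ : _ + _ = 1) ?sqrtr1 //; field.
pose S := phase_gate w 1.
pose S' := phase_gate w^* 1.
have Su : S \is unitarymx by apply: phase_gate_unitary; rewrite ?normr1.
have S'u : S' \is unitarymx by apply: phase_gate_unitary; rewrite ?normr1 // norm_conjC.
have real5 (V : qubit_op) n A B D : V \is unitarymx -> realizable n A -> realizable n B ->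
    realizable n D -> realizable (n + (n + n)) (fun U => A U *m (V *m (B U *m (V *m D U)))).
  move=> Vu Ar Br Dr; apply: realizable_mul => //.
  apply: (realizable_mul (n := 0) (F := fun=> V)); first exact: realizable_const.
  apply: realizable_mul => //.
  by apply: (realizable_mul (n := 0) (F := fun=> V)) => //; apply: realizable_const.
(* The second circuit is the adjoint of the first: order reversed, [F] and [G] exchanged, phases
   conjugated. *)
exists (m + (m + m))%N, (fun U => F U *m (S *m (G U *m (S *m F U)))),
  (fun U => G U *m (S' *m (F U *m (S' *m G U)))); split.
- by rewrite addn_gt0 m0.
- exact: real5.
- exact: real5.
move=> s t st; have [GE FE] := FG s t st.
have Uu : F (rotmx s t) \is unitarymx by apply: realizable_unitary Fr _; apply: rotmx_unitary.
split.
  by rewrite GE !trmx_mul !map_mxM !phase_gate_adj trmxCK rmorph1 !mulmxA.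
rewrite GE pi3_amplify // -normCK FE normrM normrM w1 mul1r exprMn FE.
rewrite ger0_norm; last by rewrite ler0c; apply: exprn_ge0; apply: sqr_ge0.
by rewrite -!rmorphXn -rmorphM /= -!exprM -exprD; congr ((t ^+ _)%:C)%C; rewrite expnS; lia.
Qed.

(** Sandwiching the reflection between [F] and its adjoint gives the entry |F00|^2 - |F10|^2 = 1 - 2
    |F10|^2. It is exactly -1 when [t ^+ 2 = 1], the case of odd weight, and tends to 1 as [r] grows
    when [t ^+ 2 < 1]. *)
Lemma realizable_reflection r : exists m F, [/\ (0 < m)%N, realizable m F &
  forall s t : R, s ^+ 2 + t ^+ 2 = 1 ->
    F (rotmx s t) 0 0 = ((1 - 2 * (t ^+ 2) ^+ (3 ^ r))%:C)%C].
Proof.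
have [m [F [G [m0 Fr Gr FG]]]] := realizable_amplify r.
pose Z := phase_gate 1 (-1).
have Zu : Z \is unitarymx by apply: phase_gate_unitary; rewrite ?normrN normr1.
exists (m + (0 + m))%N, (fun U => G U *m (Z *m F U)); split.
- by rewrite addn_gt0 m0.
- apply: realizable_mul => //.
  by apply: (realizable_mul (F := fun=> Z)) => //; apply: realizable_const.
move=> s t st; have [-> FE] := FG s t st.
have Uu : F (rotmx s t) \is unitarymx by apply: realizable_unitary Fr _; apply: rotmx_unitary.
have /matrixP /(_ 0 0) : (F (rotmx s t))^t* *m F (rotmx s t) = 1%:M.
  by apply/mulmx1C/unitarymxP.
rewrite rmorphB rmorph1 rmorphM rmorph_nat /= -FE normCK.
rewrite !mulmx2E !adjE !mxE /= mulr1n => E; rewrite -[X in _ = X - _]E; ring.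
Qed.
End FixedPoint.

(** * Statistics of the weights wt (x /\ q), and the algorithm for bounded weight *)

Section Weights.
Variable R : realType.

Lemma wt_bandE N (x q : bits N) : wt (band x q) = (\sum_(i | x i) q i)%N.
Proof.
rewrite /wt -sum1_card big_mkcond [RHS]big_mkcond; apply: eq_bigr => i _.
by rewrite inE ffunE; case: (x i); case: (q i).
Qed.

Lemma wt_band_le N (x q : bits N) : (wt (band x q) <= wt x)%N.
Proof.
by apply: subset_leq_card; apply/fintype.subsetP => i; rewrite !inE ffunE => /andP[].
Qed.

Lemma chi_delta N (i : 'I_N) (q : bits N) :
  chi R [ffun j => j == i] q = 1 - 2 * (q i)%:R.
Proof.
rewrite chi_prod (bigD1 i) //= big1 => [|j /negbTE ji]; last by rewrite ffunE ji.
by rewrite ffunE eqxx; case: (q i) => /=; ring.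
Qed.

Lemma deviation_chi N (x q : bits N) :
  (wt x)%:R - 2 * (wt (band x q))%:R = \sum_(i | x i) chi R [ffun j => j == i] q.
Proof.
under eq_bigr do rewrite chi_delta.
by rewrite sumrB sumr_const -big_distrr /= wt_bandE natr_sum.
Qed.

(** The deviation is a sum of [wt x] characters of distinct singletons. These are orthogonal, so
    only the diagonal terms survive. *)
Lemma deviation_second_moment N (x : bits N) :
  \sum_q ((wt x)%:R - 2 * (wt (band x q))%:R) ^+ 2 = (wt x)%:R * 2 ^+ N :> R.
Proof.
under eq_bigr do rewrite deviation_chi expr2 big_distrlr /=.
rewrite exchange_big /=.
transitivity (\sum_(i < N | x i) 2 ^+ N : R); last by rewrite sumr_const mulr_natl.
apply: eq_bigr => i xi; rewrite exchange_big /=.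
under eq_bigr do rewrite chi_orthogonal.
rewrite (bigD1 i) //= eqxx mul1r big1 ?addr0 // => j /andP[_ ji].
case: eqP => [/ffunP /(_ i)|]; last by rewrite mul0r.
by rewrite !ffunE eqxx eq_sym (negbTE ji).
Qed.

Lemma chi_even N (x q : bits N) : ~~ odd (wt (band x q)) -> chi R x q = 1.
Proof. by rewrite /chi -signr_odd => /negbTE ->. Qed.

Lemma chi_odd N (x q : bits N) : odd (wt (band x q)) -> chi R x q = -1.
Proof. by rewrite /chi -signr_odd => ->. Qed.

Lemma prob0_odd N (x q : bits N) : odd (wt (band x q)) -> prob0 R x q = 0.
Proof. by rewrite /prob0 => ow; rewrite ow; case: eqP ow => // ->. Qed.

Lemma prob0_even N (x q : bits N) :
  ~~ odd (wt (band x q)) -> (0 < wt (band x q))%N ->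
  prob0 R x q = Num.sqrt (1 / (wt (band x q))%:R).
Proof. by rewrite /prob0 lt0n => /negbTE -> /negbTE ->. Qed.

Lemma prob0_bounds N (x q : bits N) : 0 <= prob0 R x q <= 1.
Proof.
rewrite /prob0; case: eqP => [_|/eqP w0]; first by rewrite ler01 lexx.
case: ifP => _; first by rewrite ler01 lexx.
rewrite sqrtr_ge0 -[leRHS]sqrtr1; apply: ler_wsqrtr.
by rewrite ler_pdivrMr ?mul1r ?ler1n ?ltr0n lt0n.
Qed.

Lemma query_sqr N (x q : bits N) :
  Num.sqrt (prob0 R x q) ^+ 2 + Num.sqrt (1 - prob0 R x q) ^+ 2 = 1.
Proof.
by have /andP[p0 p1] := prob0_bounds x q; rewrite !sqr_sqrtr ?subr_ge0 //; ring.
Qed.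

Definition qrt (k : nat) : R := Num.sqrt (Num.sqrt k%:R).

Lemma qrt_expr4 k : qrt k ^+ 4 = k%:R.
Proof. by rewrite -[4%N]/(2 * 2)%N exprM !sqr_sqrtr ?sqrtr_ge0 ?ler0n. Qed.

Lemma qrt_ge1 k : (0 < k)%N -> 1 <= qrt k.
Proof.
by move=> k0; do 2 rewrite -[leLHS]sqrtr1 ler_wsqrtr //; rewrite ler1n.
Qed.

(** Bernoulli-type bound, by induction from (1 - e)(1 + (m + 1) e) <= 1 + m e. *)
Lemma expr_one_sub_le (e : R) m : 0 <= e <= 1 -> (1 - e) ^+ m * (1 + m%:R * e) <= 1.
Proof.
move=> /andP[e0 e1]; elim: m => [|m IH]; first by rewrite mul0r addr0 mulr1.
apply: le_trans IH; rewrite exprSr -mulrA; apply: ler_wpM2l.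
  by rewrite exprn_ge0 // subr_ge0.
rewrite -natr1; have := ler0n R m; nra.
Qed.

(** An even positive weight w is at most wt x <= b^4, so w^(-1/2) >= b^(-2); weight 0 has
    probability 1. *)
Lemma prob0_lower N (x q : bits N) (b : R) : qrt (wt x) <= b -> 1 <= b ->
  ~~ odd (wt (band x q)) -> 1 / b ^+ 2 <= prob0 R x q.
Proof.
move=> xb b1 ev; have b0 : 0 < b by apply: lt_le_trans b1.
have [w0|w0] := posnP (wt (band x q)).
  rewrite /prob0 w0 eqxx ler_pdivrMr ?exprn_gt0 // mul1r.
  by rewrite exprn_ege1.
rewrite prob0_even // ler_pdivrMr ?exprn_gt0 //.
rewrite -(@ler_pXn2r _ 2) // ?nnegrE ?mulr_ge0 ?sqrtr_ge0 ?exprn_ge0 ?(ltW b0) //.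
rewrite expr1n exprMn sqr_sqrtr ?divr_ge0 ?ler0n // -exprM mulrC mul1r.
rewrite ler_pdivlMr ?ltr0n // mul1r.
apply: (@le_trans _ _ (wt x)%:R); first by rewrite ler_nat wt_band_le.
by rewrite -qrt_expr4 lerXn2r // nnegrE ?sqrtr_ge0 // ltW.
Qed.

(** An average correlation of 5/6 is enough, since 25/36 > 2/3. The threshold is written as a sum
    over [q] to allow comparison term by term. *)
Lemma realizable_two_thirds N n F : (0 < n)%N -> realizable n F ->
  exists A : qalg R N 0, [/\ valid_qalg A, nq A = n &
   forall (x : bits N) (f : bits N -> R),
    (forall q, F (query_mx R x q) 0 0 = ((f q)%:C)%C) ->
    \sum_(q : bits N) (5 / 6) <= \sum_q chi R x q * f q ->
    (2%:R / 3%:R : R[i]) <= prob_output A x x].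
Proof.
move=> n0 /(realizable_alg N n0) [A [Av An AP]]; exists A; split=> // x f fE le_sum.
apply: le_trans (AP x f (5 / 6) fE _ _).
- rewrite (_ : 2%:R / 3%:R = ((2 / 3)%:C)%C); first by rewrite lecR; lra.
  by rewrite fmorph_div !rmorph_nat.
- lra.
apply: le_trans le_sum.
by rewrite sumr_const card_ffun card_bool card_ord -[leRHS]mulr_natr natrX.
Qed.

(** The number of queries is fixed before [N]: the gap [e] between even and odd weights depends on
    [b] alone. *)
Lemma bounded_weight_alg (b : R) : 1 <= b -> exists m : nat, forall N,
  exists A : qalg R N 0, [/\ valid_qalg A, nq A = m &
   forall x : bits N, qrt (wt x) <= b -> (2%:R / 3%:R : R[i]) <= prob_output A x x].
Proof.
move=> b1; have b0 : 0 < b by apply: lt_le_trans b1.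
have b2 : 1 <= b ^+ 2 by rewrite exprn_ege1.
pose e := 1 / b ^+ 2.
have e0 : 0 < e by rewrite divr_gt0 // (lt_le_trans ltr01).
have e1 : e <= 1 by rewrite ler_pdivrMr ?mul1r // (lt_le_trans ltr01).
(* With 3^(r+1) e >= 11, [expr_one_sub_le] bounds the failure probability by 1/12, and 1 - 2/12 =
   5/6. *)
pose r := Num.trunc (11 / e).
have re : 11 <= (3 ^ r.+1)%:R * e.
  rewrite -ler_pdivrMr //; apply: (@le_trans _ _ r.+1%:R).
    by apply/ltW/truncnS_gt.
  by rewrite ler_nat ltnW // ltn_expl.
have [m [F [m0 Fr FE]]] := realizable_reflection R r.+1.
exists m => N; have [A [Av An AP]] := realizable_two_thirds N m0 Fr.
exists A; split=> // x xb.
apply: (AP x (fun q => 1 - 2 * (1 - prob0 R x q) ^+ (3 ^ r.+1))).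
  move=> q; rewrite FE ?query_sqr // sqr_sqrtr //.
  by have /andP[_ p1] := prob0_bounds x q; rewrite subr_ge0.
apply: ler_sum => q _.
have [ow|ew] := boolP (odd (wt (band x q))).
  by rewrite chi_odd // prob0_odd // subr0 expr1n; lra.
rewrite chi_even // mul1r.
have /andP[p0 p1] := prob0_bounds x q.
have pe : e <= prob0 R x q by apply: prob0_lower.
suff : (1 - prob0 R x q) ^+ (3 ^ r.+1) <= 1 / 12 by lra.
apply: (@le_trans _ _ ((1 - e) ^+ (3 ^ r.+1))).
  by apply: lerXn2r; rewrite ?nnegrE ?subr_ge0 // lerD2l lerN2.
have := @expr_one_sub_le e (3 ^ r.+1); rewrite (ltW e0) e1 => /(_ isT).
have : 0 <= (1 - e) ^+ (3 ^ r.+1) by rewrite exprn_ge0 // subr_ge0.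
move: re; move: (_ * e) ((1 - e) ^+ _) => u v; nra.
Qed.

End Weights.

(** * Trigonometric bounds and powers of the query rotation *)

Section Rotations.
Local Open Scope classical_set_scope.
Variable R : realType.
Implicit Types x y a b phi : R.

Lemma sin_increment x : 0 <= x -> exists2 c, c \in `[0, x]%R & sin x = cos c * x.
Proof.
move=> x0; have sc : {within `[0, x], continuous (@sin R)}.
  by apply: continuous_subspaceT => z; apply: continuous_sin.
have [c cx] := MVT_segment x0 (fun y _ => is_derive_sin y) sc.
by rewrite sin0 !subr0 => sinE; exists c.
Qed.

Lemma abs_sin_le x : 0 <= x -> `|sin x| <= x.
Proof.
move=> x0; have [c _ ->] := sin_increment x0.
by rewrite normrM (ger0_norm x0) ler_piMl // cos_max.
Qed.

(** From cos x = 1 - 2 sin^2 (x/2) and |sin (x/2)| <= |x|/2. *)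
Lemma cos_quadratic_lower x : 1 - x ^+ 2 / 2 <= cos x.
Proof.
rewrite -(cos_norm x) -(real_normK (num_real x)).
have : 0 <= `|x| by []. move: (`|x|) => {x} y y0.
rewrite [in leRHS](_ : y = (y / 2) *+ 2); last by rewrite -mulr_natr; field.
rewrite cos_mulr2n cos2sin2.
have := @abs_sin_le (y / 2); rewrite divr_ge0 // => /(_ isT).
rewrite -(@ler_pXn2r _ 2) ?nnegrE ?divr_ge0 // real_normK ?num_real //.
rewrite exprMn; lra.
Qed.

(** By the mean value theorem sin x = x cos c with c in [0, x], where cosine decreases. *)
Lemma mul_cos_le_sin x : 0 <= x <= pi / 2 -> x * cos x <= sin x.
Proof.
move=> /andP[x0 xpi]; have [c] := sin_increment x0.
rewrite in_itv /= => /andP[c0 cx] ->.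
rewrite mulrC ler_wpM2r //; move: cx; rewrite le_eqVlt => /predU1P[->//|cx].
have pi0 := pi_gt0 R.
by apply/ltW; rewrite ltr_cos ?in_itv //=; apply/andP; split; lra.
Qed.

Lemma rotmx_mul a b :
  rotmx (cos a) (sin a) *m rotmx (cos b) (sin b) = rotmx (cos (a + b)) (sin (a + b)).
Proof.
by apply: qubit_opP; rewrite mulmx2E !mxE /= -!rmorphM -rmorphD /= ?cosD ?sinD; 
   congr (_%:C)%C; ring.
Qed.

Lemma realizable_power n : exists2 F, realizable n F &
  forall a, F (rotmx (cos a) (sin a)) = rotmx (cos (n%:R * a)) (sin (n%:R * a)).
Proof.
elim: n => [|n [F Fr FE]].
  exists (fun=> 1%:M) => [|a].
    by apply: realizable_const; apply/unitarymxP; rewrite mul1mx trmx1 map_mx1.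
  by rewrite mul0r cos0 sin0; apply: qubit_opP; rewrite !mxE /= ?oppr0.
exists (fun U => U *m F U) => [|a].
  by apply: (realizable_mul (n := 1) (F := id)) => //; apply: realizable_query.
by rewrite FE rotmx_mul -nat1r mulrDl mul1r.
Qed.

(** For n = 4m + 2 the total angle n (pi/2 - phi) is 2 pi m - (n phi - pi), and cosine is even and
    periodic. *)
Lemma realizable_grover m : exists2 F, realizable (4 * m + 2) F &
  forall phi, F (rotmx (sin phi) (cos phi)) 0 0 =
    ((cos ((4 * m + 2)%:R * phi - pi))%:C)%C.
Proof.
have [F Fr FE] := realizable_power (4 * m + 2); exists F => // phi.
have -> : rotmx (sin phi) (cos phi) = rotmx (cos (pi / 2 - phi)) (sin (pi / 2 - phi)).
  by rewrite cosB sinB cos_pihalf sin_pihalf; congr rotmx; ring.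
rewrite FE mxE /=; congr (_%:C)%C.
rewrite -[RHS]cosN -[RHS](periodicn (@cosD2pi R) m); congr cos.
by rewrite -mulrnA -[pi *+ _]mulr_natr natrM natrD natrM; field.
Qed.

End Rotations.

(** * The algorithm for large weight *)

Section LargeWeight.
Variable R : realType.

(** The window surrounds the ideal value 2^(-1/4) pi r, about 0.84 pi r. Its length is at least 8,
    so it contains an integer congruent to 2 modulo 4. *)
Lemma query_count_exists (r : R) : 40 <= r ->
  exists m : nat, (78 / 100) * (pi * r) <= (4 * m + 2)%:R <= (88 / 100) * (pi * r).
Proof.
move=> r40; have p2 := pi_ge2 R.
have pr : 80 <= pi * r by nra.
pose v := ((88 / 100) * (pi * r) - 2) / 4.
have v0 : 0 <= v by rewrite /v; lra.
have /andP[m1 m2] := truncn_itv v0.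
exists (Num.trunc v); rewrite natrD natrM.
move: m1 m2; rewrite -natr1 /v; move: (Num.trunc _)%:R => t m1 m2.
apply/andP; split; lra.
Qed.

(** Applied with r = k^(1/4) and y = w^(-1/4), so that (y r)^4 = k/w. The phase [n * asin y] stays
    within pi/8 < 1/2 of pi, and 1 - (1/2)^2 / 2 = 7/8. *)
Lemma typical_phase (r n y : R) :
  40 <= r -> (78 / 100) * (pi * r) <= n <= (88 / 100) * (pi * r) ->
  0 <= y -> 5 / 3 <= (y * r) ^+ 4 <= 5 / 2 ->
  7 / 8 <= cos (n * asin y - pi).
Proof.
move=> r40 /andP[n1 n2] y0 /andP[y1 y2].
have p0 := pi_gt0 R; have p4 : pi <= 4 :> R by have := pihalf_lt2 R; lra.
have yr0 : 0 <= y * r by nra.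
have lo : 113 / 100 <= y * r.
  rewrite -(@ler_pXn2r _ 4) ?nnegrE //; last by lra.
  by apply: le_trans y1; rewrite !exprS expr0; lra.
have hi : y * r <= 126 / 100.
  rewrite -(@ler_pXn2r _ 4) ?nnegrE //; last by lra.
  by apply: le_trans y2 _; rewrite !exprS expr0; lra.
have ys : y <= 1 / 30 by nra.
have yin : -1 <= y <= 1 by apply/andP; split; lra.
have yin' : y \in `[-1, 1]%R by rewrite in_itv.
set phi := asin y.
have sphi : sin phi = y by apply: asinK.
(* Since y <= 1/30, replacing asin y by y costs at most a factor 100/99. *)
have cphi : 99 / 100 <= cos phi.
  rewrite cos_asin //; have := sqrtr_ge0 (1 - y ^+ 2).
  have : Num.sqrt (1 - y ^+ 2) ^+ 2 = 1 - y ^+ 2 by rewrite sqr_sqrtr //; nra.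
  move: (Num.sqrt _) => c; nra.
have phipi : phi <= pi / 2 by apply: asin_lepi2.
have phi0 : 0 <= phi.
  rewrite leNgt; apply/negP => phin.
  have := @ltr_sin R phi 0; rewrite !in_itv /= sphi sin0 phin asin_geNpi2 ?phipi //=.
  by rewrite oppr_le0 divr_ge0 ?(ltW p0) //= => /(_ isT isT); lra.
have yphi : y <= phi.
  by have := abs_sin_le phi0; rewrite sphi ger0_norm.
have phiy : phi * cos phi <= y.
  by rewrite -[leRHS]sphi; apply: mul_cos_le_sin; rewrite phi0.
have n0 : 0 <= n by nra.
(* The margins are 0.78 * 1.13 > 7/8 here and 0.88 * 1.26 / 0.99 < 9/8 below. *)
have nlo : 7 / 8 * pi <= n * phi.
  have : n * y <= n * phi by rewrite ler_wpM2l.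
  have : (78 / 100) * (pi * r) * y <= n * y by rewrite ler_wpM2r.
  have : pi * (113 / 100) <= pi * (y * r) by rewrite ler_wpM2l // ltW.
  lra.
have nhi : n * phi <= 9 / 8 * pi.
  have h1 : n * phi * cos phi <= n * y by rewrite -mulrA ler_wpM2l.
  have h2 : n * y <= (88 / 100) * (pi * r) * y by rewrite ler_wpM2r.
  have h3 : pi * (y * r) <= pi * (126 / 100) by rewrite ler_wpM2l // ltW.
  have h4 : n * phi * (99 / 100) <= n * phi * cos phi by rewrite ler_wpM2l // mulr_ge0.
  lra.
apply: le_trans (cos_quadratic_lower _); nra.
Qed.

Lemma large_weight_alg (r : R) : 40 <= r ->
  exists2 n : nat, n%:R <= 4 * r & forall N,
  exists A : qalg R N 0, [/\ valid_qalg A, nq A = n &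
   forall x : bits N, qrt R (wt x) = r -> (2%:R / 3%:R : R[i]) <= prob_output A x x].
Proof.
move=> r40; have [m mb] := query_count_exists r40.
exists (4 * m + 2)%N.
  have /andP[_ mu] := mb; apply: le_trans mu _.
  by have := pihalf_lt2 R; nra.
move=> N; have [F Fr FE] := realizable_grover R m.
have n0 : (0 < 4 * m + 2)%N by rewrite addn2.
have [A [Av An AP]] := realizable_two_thirds N n0 Fr.
exists A; split=> // x xr.
pose s q := Num.sqrt (prob0 R x q).
apply: (AP x (fun q => cos ((4 * m + 2)%:R * asin (s q) - pi))) => [q|].
  rewrite -FE; congr (F _ _ _).
  have /andP[p0 p1] := prob0_bounds R x q.
  have s1 : -1 <= s q <= 1.
    rewrite (le_trans _ (sqrtr_ge0 _)) ?lerN10 //=.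
    by rewrite -[leRHS]sqrtr1 ler_wsqrtr.
  by rewrite cos_asin // asinK ?in_itv // /s sqr_sqrtr.
pose k : R := (wt x)%:R.
have kr : k = r ^+ 4 by rewrite -xr qrt_expr4.
(* This makes the average loss 50/k at most 1/24, and 7/8 - 1/24 = 5/6. *)
have k0 : 1200 <= k.
  have r2 : 1600 <= r ^+ 2 by nra.
  by rewrite kr -[4%N]/(2 * 2)%N exprM; nra.
pose d q : R := k - 2 * (wt (band x q))%:R.
(* Queries with [d q ^+ 2 > k ^+ 2 / 25] cost at most 2, whence the factor 50. *)
apply: (@le_trans _ _ (\sum_(q : bits N) (7 / 8 - 50 / k ^+ 2 * d q ^+ 2))).
  have dE : \sum_q d q ^+ 2 = k * 2 ^+ N by exact: deviation_second_moment.
  rewrite sumrB -[X in _ - X]big_distrr /= dE.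
  rewrite !sumr_const card_ffun card_bool card_ord.
  rewrite -[(5 / 6) *+ _]mulr_natl -[(7 / 8) *+ _]mulr_natl natrX.
  have e2 : 0 < 2 ^+ N :> R by rewrite exprn_gt0.
  have -> : 50 / k ^+ 2 * (k * 2 ^+ N) = 2 ^+ N * (50 / k).
    by field; rewrite gt_eqF //; lra.
  rewrite -mulrBr ler_pM2l //.
  have : 50 / k <= 1 / 24 by rewrite ler_pdivrMr; lra.
  lra.
apply: ler_sum => q _.
have dd : 0 <= 50 / k ^+ 2 * d q ^+ 2 by rewrite mulr_ge0 ?sqr_ge0 // divr_ge0 ?sqr_ge0.
have [ow|ew] := boolP (odd (wt (band x q))).
  rewrite chi_odd // /s prob0_odd // sqrtr0.
  have -> : asin 0 = 0 :> R.
    by rewrite -[in LHS](sin0 R) sinK // in_itv /= oppr_le0 divr_ge0 // ltW // pi_gt0.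
  by rewrite mulr0 sub0r cosN cospi; lra.
rewrite chi_even // mul1r.
(* Outside [2k/5, 3k/5] the subtracted term is at least 2, so the trivial bound cos >= -1 suffices.
   This also disposes of weight 0. *)
have [wlo|wlo] := lerP ((2 / 5) * k) (wt (band x q))%:R; last first.
  apply: le_trans (cos_geN1 _).
  suff : 2 <= 50 / k ^+ 2 * d q ^+ 2 by lra.
  rewrite mulrAC ler_pdivlMr ?exprn_gt0 //; last by lra.
  rewrite /d; move: (wt (band x q))%:R wlo => w wlo.
  have : k / 5 <= k - 2 * w by lra.
  nra.
have [whi|whi] := lerP (wt (band x q))%:R ((3 / 5) * k); last first.
  apply: le_trans (cos_geN1 _).
  suff : 2 <= 50 / k ^+ 2 * d q ^+ 2 by lra.
  rewrite mulrAC ler_pdivlMr ?exprn_gt0 //; last by lra.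
  rewrite /d; move: (wt (band x q))%:R whi => w whi.
  have : k / 5 <= 2 * w - k by lra.
  nra.
apply: (@le_trans _ _ (7 / 8)); first by lra.
have w0 : 0 < (wt (band x q))%:R :> R by lra.
apply: (typical_phase r40 mb); first exact: sqrtr_ge0.
have s4 : s q ^+ 4 = 1 / (wt (band x q))%:R.
  by rewrite /s prob0_even -?(ltr0n R) // (exprM _ 2 2) !sqr_sqrtr ?sqrtr_ge0 ?divr_ge0.
rewrite exprMn -kr s4 mulrAC mul1r ler_pdivlMr // ler_pdivrMr //.
by apply/andP; split; lra.
Qed.

End LargeWeight.

Theorem theorem3 (R : realType) :
  exists c : R, 0 < c /\
  forall N k : nat, (1 <= k)%N -> (2 * k < N)%N ->
  exists (W : nat) (A : qalg R N W),
    valid_qalg A /\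
    (nq A)%:R <= c * Num.sqrt (Num.sqrt (k%:R : R)) /\
    forall x : bits N, wt x = k -> (2%:R / 3%:R : R[i]) <= prob_output A x x.
Proof.
have [m small] := @bounded_weight_alg R 40 ltac:(lra).
(* The large case needs at most 4 k^(1/4) queries; the constant [m] of the bounded case is absorbed
   because k^(1/4) >= 1. *)
exists (4 + m%:R); split; first by rewrite ltr_wpDr.
move=> N k k1 _; have r1 : 1 <= qrt R k by apply: qrt_ge1.
rewrite -/(qrt R k); have [rb|/ltW rb] := lerP (qrt R k) 40.
  have [A [Av An AP]] := small N; exists 0%N, A; split=> //; split.
    by rewrite An; have := ler0n R m; nra.
  by move=> x xk; apply: AP; rewrite xk.
have [n nr large] := large_weight_alg rb.
have [A [Av An AP]] := large N; exists 0%N, A; split=> //; split.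
  by rewrite An; have := ler0n R m; nra.
by move=> x xk; apply: AP; rewrite xk.
Qed.
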